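(* Let $E$ and $F$ be Banach spaces, let $L\subset E$ be a closed infinite-codimensional subspace, let $T:E\to F$ be a bounded linear operator with the Kato property for $L$, and let $R\in\mathcal R_d(E)$. If $\mathrm{codim}_E(L+R)=\infty$, then there exists a closed subspace $E_1\subset E$ such that (a) $L\subset E_1$; (b) $E/E_1$ is separable and infinite-dimensional; (c) $\mathrm{codim}_E(E_1+R)=\infty$; and (d) $\overline{T(E_1)}=\overline{T(E)}$.
   Context: All spaces are real. For a closed subspace $L$ of $E$, $Q_L:E\to E/L$ is the canonical quotient map. A bounded linear operator $T:E\to F$ has the Kato property for a closed infinite-codimensional subspace $L\subset E$ if for every closed finite-codimensional subspace $W\subset E$ with $L\subset W$ and every $\varepsilon>0$ there exists $u\in W\setminus L$ such that $\|T(u)\|\le \varepsilon\|Q_L(u)\|$. A linear subspace $R\subset E$ is an operator range in $E$ if there exist a Banach space $G$ and a bounded linear operator $A:G\to E$ with $A(G)=R$. $\mathcal R_d(E)$ denotes the class of proper (i.e. $\neq E$) dense operator ranges in $E$. *)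

(* Defs.v *)
From HB Require Import structures.
From mathcomp Require Import all_boot all_order all_algebra.
From mathcomp Require Import all_classical all_reals all_analysis.

Set Implicit Arguments.
Unset Strict Implicit.
Unset Printing Implicit Defensive.

Import Order.TTheory GRing.Theory Num.Theory.
Import numFieldNormedType.Exports.

Local Open Scope classical_set_scope.
Local Open Scope ring_scope.
Local Open Scope quotient_scope.

(* A linear subspace S of E is a [submodClosed E], i.e. a boolean predicate
   closed under the vector space operations; [set` S] is its underlying set. *)

HB.mixin Record isTopClosed (K : realType) (E : normedModType K)
    (S : E -> bool) := {
  topclosed_subproof : closed [set` S]
}.

#[short(type="closedSubspace")]
HB.structure Definition ClosedSubspace (K : realType) (E : normedModType K) :=
  {S of GRing.SubmodClosed K S & isTopClosed K E S}.

Lemma closed_subspace (K : realType) (E : normedModType K)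
  (L : closedSubspace E) : closed [set` L].
Proof. exact: topclosed_subproof. Qed.

Lemma closed_subspaceP (K : realType) (E : normedModType K) (S : {pred E}) :
  submod_closed S -> closed [set` S] ->
  exists L : closedSubspace E, L =i S.
Proof.
move=> Ssub Scl.
pose m1 := GRing.isSubmodClosed.Build K E S (GRing.submod_closed_semi Ssub).
pose m2 := isTopClosed.Build K E S Scl.
pose L : closedSubspace E := HB.pack S m1 m2.
by exists L.
Qed.

Section AlgebraicQuotient.
Variables (K : realType) (E : lmodType K) (S : submodClosed E).

Lemma subspace_zmod_closed : zmod_closed S.
Proof.
split=> [|x y xS yS]; first exact: rpred0.
by rewrite -scaleN1r rpredD// rpredZ.
Qed.

(* The library's quotient of a Z-module by a subgroup; S is repackaged because
   [submodClosed] does not inherit from [zmodClosed]. *)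
Definition subspace_zmod : {pred E} := S.
HB.instance Definition _ :=
  GRing.isZmodClosed.Build E subspace_zmod subspace_zmod_closed.

Definition quot_lmod : Type := Quotient.quot subspace_zmod.

HB.instance Definition _ := Choice.on quot_lmod.
HB.instance Definition _ := GRing.Zmodule.on quot_lmod.

Definition quot_lmod_pi (x : E) : quot_lmod :=
  \pi_(Quotient.quot subspace_zmod) x.

Lemma quot_lmod_pi_is_zmod_morphism : zmod_morphism quot_lmod_pi.
Proof. exact: raddfB. Qed.

Lemma quot_lmod_pi_eq (x y : E) :
  (quot_lmod_pi x == quot_lmod_pi y) = (x - y \in S).
Proof. by rewrite -Quotient.idealrBE. Qed.

Lemma quot_lmod_pi_surj (q : quot_lmod) : exists x, quot_lmod_pi x = q.
Proof.
by exists (repr (q : Quotient.quot subspace_zmod)); rewrite /quot_lmod_pi reprK.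
Qed.

Definition quot_lmod_scale (a : K) (q : quot_lmod) : quot_lmod :=
  quot_lmod_pi (a *: repr (q : Quotient.quot subspace_zmod)).

Lemma quot_lmod_scaleE (a : K) (x : E) :
  quot_lmod_scale a (quot_lmod_pi x) = quot_lmod_pi (a *: x).
Proof.
apply/eqP; rewrite quot_lmod_pi_eq -scalerBr rpredZ// -quot_lmod_pi_eq.
by rewrite /quot_lmod_pi reprK.
Qed.

Let piB := quot_lmod_pi_is_zmod_morphism.

HB.instance Definition _ :=
  GRing.isZmodMorphism.Build E quot_lmod quot_lmod_pi piB.

Lemma quot_lmod_scaleA a b q : quot_lmod_scale a (quot_lmod_scale b q) =
  quot_lmod_scale (a * b) q.
Proof.
by have [x <-] := quot_lmod_pi_surj q; rewrite !quot_lmod_scaleE scalerA.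
Qed.

Lemma quot_lmod_scale1 : left_id 1 quot_lmod_scale.
Proof.
by move=> q; have [x <-] := quot_lmod_pi_surj q; rewrite quot_lmod_scaleE scale1r.
Qed.

Lemma quot_lmod_scaleDr : right_distributive quot_lmod_scale +%R.
Proof.
move=> a q r; have [x <-] := quot_lmod_pi_surj q.
have [y <-] := quot_lmod_pi_surj r.
by rewrite -raddfD !quot_lmod_scaleE -raddfD scalerDr.
Qed.

Lemma quot_lmod_scaleDl q : {morph quot_lmod_scale^~ q : a b / a + b}.
Proof.
move=> a b; have [x <-] := quot_lmod_pi_surj q.
by rewrite !quot_lmod_scaleE -raddfD scalerDl.
Qed.

HB.instance Definition _ := GRing.Zmodule_isLmodule.Build K quot_lmod
  quot_lmod_scaleA quot_lmod_scale1 quot_lmod_scaleDr quot_lmod_scaleDl.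

Lemma quot_lmod_pi_is_scalable : scalable quot_lmod_pi.
Proof. by move=> a x; rewrite -quot_lmod_scaleE. Qed.

HB.instance Definition _ := GRing.isScalable.Build K E quot_lmod *:%R
  quot_lmod_pi quot_lmod_pi_is_scalable.

End AlgebraicQuotient.

Section NormedQuotient.
Variables (K : realType) (E : normedModType K) (L : closedSubspace E).

Definition quot_space : Type := quot_lmod L.
HB.instance Definition _ := GRing.Lmodule.on quot_space.

Definition quot_map (x : E) : quot_space := quot_lmod_pi L x.
HB.instance Definition _ := GRing.Linear.copy quot_map (quot_lmod_pi L).

Lemma quot_map_eq (x y : E) : (quot_map x == quot_map y) = (x - y \in L).
Proof. exact: quot_lmod_pi_eq. Qed.

Lemma quot_map_surj (q : quot_space) : exists x, quot_map x = q.
Proof. exact: quot_lmod_pi_surj. Qed.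

Definition quot_norm (q : quot_space) : K :=
  inf [set `|x| | x in [set x | quot_map x = q]].

Lemma quot_norm_has_inf (q : quot_space) :
  has_inf [set `|x| | x in [set x | quot_map x = q]].
Proof.
split; last by exists 0 => _ [x _ <-].
by have [x xq] := quot_map_surj q; exists `|x|, x.
Qed.

Lemma quot_norm_le (x : E) : quot_norm (quot_map x) <= `|x|.
Proof. by apply: ge_inf; [case: (quot_norm_has_inf (quot_map x))|exists x]. Qed.

Lemma quot_norm_ge0 (q : quot_space) : 0 <= quot_norm q.
Proof. by apply: lb_le_inf; [case: (quot_norm_has_inf q)|move=> _ [x _ <-]]. Qed.

Lemma quot_norm_adherent (q : quot_space) (e : K) : 0 < e ->
  exists2 x, quot_map x = q & `|x| < quot_norm q + e.
Proof.
by move=> e0; have [_ [x xq <-] lt] := inf_adherent e0 (quot_norm_has_inf q);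
  exists x.
Qed.

Lemma quot_norm_triangle (p q : quot_space) :
  quot_norm (p + q) <= quot_norm p + quot_norm q.
Proof.
apply/ler_addgt0Pr => e e0.
have e20 : 0 < e / 2 by rewrite divr_gt0.
have [x xp ltx] := quot_norm_adherent p e20.
have [y yq lty] := quot_norm_adherent q e20.
rewrite -xp -yq -raddfD (le_trans (quot_norm_le _))// xp yq.
rewrite (le_trans (ler_normD _ _))// [e]splitr addrACA.
by rewrite lerD// ltW.
Qed.

Lemma quot_norm_scale_le (a : K) (q : quot_space) :
  quot_norm (a *: q) <= `|a| * quot_norm q.
Proof.
apply/ler_addgt0Pr => e e0.
have a0 : 0 < `|a| + 1 by rewrite ltr_wpDl.
have [x xq ltx] := quot_norm_adherent q (divr_gt0 e0 a0).
rewrite -xq -linearZ (le_trans (quot_norm_le _))// normrZ xq.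
rewrite (le_trans (ler_wpM2l _ (ltW ltx)))// mulrDr lerD2l.
have a1 : `|a| / (`|a| + 1) <= 1 by rewrite ler_pdivrMr// mul1r lerDl.
by rewrite mulrCA ler_piMr// ltW.
Qed.

Lemma quot_normZ (a : K) (q : quot_space) :
  quot_norm (a *: q) = `|a| * quot_norm q.
Proof.
apply/eqP; rewrite eq_le quot_norm_scale_le/=.
have [->|a0] := eqVneq a 0; first by rewrite normr0 mul0r quot_norm_ge0.
rewrite -{1}[q](scalerK a0) -ler_pdivlMl ?normr_gt0//.
by rewrite (le_trans (quot_norm_scale_le _ _))// normrV ?unitfE.
Qed.

Lemma quot_norm0_eq0 (q : quot_space) : quot_norm q = 0 -> q = 0.
Proof.
move=> q0; have [y yq] := quot_map_surj q.
suff yL : y \in L by apply/eqP; rewrite -yq -(raddf0 quot_map) quot_map_eq subr0.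
apply: (@closed_subspace _ _ L) => U /nbhs_ballP[e /= e0 yU].
have [x xq] := quot_norm_adherent q e0; rewrite q0 add0r => ltx.
exists (y - x); split; first by rewrite /= -quot_map_eq yq xq.
by apply: yU; rewrite -ball_normE /= opprB addrCA subrr addr0.
Qed.

HB.instance Definition _ := Lmodule_isNormed.Build K quot_space
  quot_norm_triangle quot_normZ quot_norm0_eq0.

End NormedQuotient.

Section SumSubspace.
Variables (K : realType) (E : lmodType K) (S1 S2 : submodClosed E).

Definition sum_pred : {pred E} :=
  fun x => `[< exists y z, [/\ y \in S1, z \in S2 & x = y + z] >].

Lemma sum_subspace_closed : subsemimod_closed sum_pred.
Proof.
split; first split.
- by apply/asboolP; exists 0, 0; rewrite !rpred0 addr0.
- move=> _ _ /asboolP[y1 [z1 [? ? ->]]] /asboolP[y2 [z2 [? ? ->]]].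
  by apply/asboolP; exists (y1 + y2), (z1 + z2); rewrite !rpredD// addrACA.
- move=> a _ /asboolP[y [z [? ? ->]]].
  by apply/asboolP; exists (a *: y), (a *: z); rewrite !rpredZ// scalerDr.
Qed.

HB.instance Definition _ :=
  GRing.isSubmodClosed.Build K E sum_pred sum_subspace_closed.

Definition sum_subspace : submodClosed E := sum_pred.

End SumSubspace.

Definition finite_dim (K : realType) (V : lmodType K) : Prop :=
  exists (n : nat) (v : 'I_n -> V),
    forall x, exists a : 'I_n -> K, x = \sum_(i < n) a i *: v i.

Definition finite_codim (K : realType) (E : lmodType K) (S : submodClosed E) :
  Prop := finite_dim (quot_lmod S).

Definition infinite_codim (K : realType) (E : lmodType K)
  (S : submodClosed E) : Prop := ~ finite_codim S.

Definition separable (T : topologicalType) : Prop :=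
  exists2 D : set T, countable D & dense D.

Definition bounded_operator (K : realType) (E F : normedModType K)
  (T : {linear E -> F}) : Prop :=
  exists M : K, forall x, `|T x| <= M * `|x|.

Definition kato_property (K : realType) (E F : normedModType K)
    (T : {linear E -> F}) (L : closedSubspace E) : Prop :=
  forall W : closedSubspace E, finite_codim W -> {subset L <= W} ->
  forall e : K, 0 < e ->
  exists u, [/\ u \in W, u \notin L & `|T u| <= e * `|quot_map L u|].

Definition operator_range (K : realType) (E : normedModType K)
    (S : submodClosed E) : Prop :=
  exists (G : completeNormedModType K) (A : {linear G -> E}),
    bounded_operator A /\ range A = [set` S].

Definition proper_dense_operator_range (K : realType) (E : normedModType K)
    (S : submodClosed E) : Prop :=
  [/\ operator_range S, dense [set` S] & [set` S] <> setT].

(* Main.v *)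
(* Write R = A(G) and let every functional below annihilate L. One builds a
   biorthogonal system consisting of pairs (u_i, f_i) with |u_i| <= 1 and
   |f_i o A| <= 8^-i, available because A is not onto modulo L plus any
   finite-dimensional space (open mapping argument), and of pairs (w_j, h_j) with
   |h_j| <= 8^-j and |T w_j| <= 8^-j, provided by the Kato property. Splitting the
   indices j into infinite classes N_i, put g_i = f_i + sum_(j in N_i) h_j and
   let E1 be the common kernel of the g_i.
   - For x in R the series sum_i g_i(x) u_i converges and its difference with x
     lies in E1; hence E1 + span(u_i) is dense and E/E1 is separable.
   - For j in N_i the vector u_i - w_j lies in E1, and T w_j -> 0; hence T u_i lies
     in the closure of T(E1).
   - |g_i(x)| = O(4^-i) on E1 + R, whereas g_i takes the values 2^-i, for i in any
     one of infinitely many disjoint infinite classes, on suitable series in the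
     u_k; hence E1 + R has infinite codimension. *)
From HB Require Import structures.
Require Import Defs.
From mathcomp Require Import all_boot all_order all_algebra.
From mathcomp Require Import all_classical all_reals all_analysis.
From mathcomp Require Import ring lra.

Set Implicit Arguments.
Unset Strict Implicit.
Unset Printing Implicit Defensive.

Import Order.TTheory GRing.Theory Num.Theory.
Import numFieldNormedType.Exports.

Local Open Scope classical_set_scope.
Local Open Scope ring_scope.

(** * Hahn-Banach theorem for sublinear functions *)

Section HahnBanach.
Variables (K : realType) (E : lmodType K).
Implicit Types (p q : E -> K) (x y : E).

Definition sublinear q :=
  (forall x y, q (x + y) <= q x + q y) /\
  (forall a x, 0 < a -> q (a *: x) <= a * q x).

Lemma sublinear0 q : sublinear q -> q 0 = 0.
Proof.
case=> qD qZ; have h2 : 0 < 2^-1 :> K by rewrite invr_gt0.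
have := qZ _ 0 h2; have := qD 0 0; rewrite scaler0 addr0; lra.
Qed.

Lemma sublinearZ q a x : sublinear q -> 0 <= a -> q (a *: x) = a * q x.
Proof.
move=> sq; rewrite le_eqVlt => /predU1P[<-|a0].
  by rewrite scale0r mul0r sublinear0.
have [_ qZ] := sq; apply/eqP; rewrite eq_le qZ//=.
have ia : 0 < a^-1 by rewrite invr_gt0.
have := qZ _ (a *: x) ia; rewrite scalerA mulVf ?gt_eqF// scale1r.
by rewrite ler_pdivlMl.
Qed.

Lemma sublinear_ge q x y : sublinear q -> - q (- x) <= q (x + y) - q y.
Proof.
by move=> [qD _]; have := qD (- x) (x + y); rewrite addKr; lra.
Qed.

(** For sublinear [q], the largest sublinear [r] below [q] with [r (- y) <= - q y]; it forces a
    linear minorant to touch [q] at [y]. *)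
Definition slope q y x := inf [set q (x + t *: y) - t * q y | t in [set t | 0 <= t]].

Lemma slope_has_inf q y x : sublinear q ->
  has_inf [set q (x + t *: y) - t * q y | t in [set t | 0 <= t]].
Proof.
move=> sq; split; first by exists (q (x + 0 *: y) - 0 * q y), 0 => //=.
exists (- q (- x)) => _ [t /= t0 <-].
by rewrite -sublinearZ//; exact: sublinear_ge.
Qed.

Lemma slope_le q y x t : sublinear q -> 0 <= t ->
  slope q y x <= q (x + t *: y) - t * q y.
Proof. by move=> sq t0; apply: ge_inf; [case: (slope_has_inf y x sq)|exists t]. Qed.

Lemma sublinear_slope q y : sublinear q -> sublinear (slope q y).
Proof.
move=> sq; have [qD qZ] := sq; split=> [x z|a x a0].
  apply/ler_addgt0Pr => e e0; have e2 : 0 < e / 2 by rewrite divr_gt0.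
  (* Near-optimal parameters for [x] and [z] add up to an admissible one for [x + z]. *)
  have [_ [s /= s0 <-] lts] := inf_adherent e2 (slope_has_inf y x sq).
  have [_ [t /= t0 <-] ltt] := inf_adherent e2 (slope_has_inf y z sq).
  have := slope_le y (x + z) sq (addr_ge0 s0 t0).
  have := qD (x + s *: y) (z + t *: y).
  rewrite addrACA -scalerDl mulrDl -/(slope q y x) -/(slope q y z) in lts ltt *.
  lra.
apply/ler_addgt0Pr => e e0; have ea : 0 < e / a by rewrite divr_gt0.
have [_ [s /= s0 <-] lts] := inf_adherent ea (slope_has_inf y x sq).
have as0 : 0 <= a * s by rewrite mulr_ge0// ltW.
have := slope_le y (a *: x) sq as0; rewrite -scalerA -scalerDr.
rewrite (sublinearZ _ sq (ltW a0)) -mulrA -mulrBr => /le_trans; apply.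
rewrite -/(slope q y x) in lts.
have : a * (q (x + s *: y) - s * q y) < a * (slope q y x + e / a).
  by rewrite ltr_pM2l.
by rewrite [ltRHS]mulrDr (mulrC e) mulVKf ?gt_eqF// => /ltW.
Qed.

Lemma slope_le_id q y x : sublinear q -> slope q y x <= q x.
Proof.
by move=> sq; have := slope_le y x sq (lexx 0); rewrite scale0r addr0 mul0r subr0.
Qed.

Lemma slope_opp q y : sublinear q -> slope q y (- y) <= - q y.
Proof.
move=> sq; have := slope_le y (- y) sq ler01.
by rewrite scale1r addNr sublinear0// mul1r sub0r.
Qed.

(* By Zorn there is a minimal sublinear function below [p]; a minimal one
   equals each of its own [slope]s and is therefore odd, hence linear. *)
Lemma exists_linear_le p : sublinear p ->
  exists f : {linear E -> K^o}, forall x, f x <= p x.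
Proof.
move=> sp; pose P q := sublinear q /\ forall x, q x <= p x.
pose T := {q | P q}.
(* [R] reverses the pointwise order, so the maximal element given by Zorn is a minimal sublinear
   function. *)
pose R (q r : T) := `[< forall x, sval r x <= sval q x >].
have t0 : T by exists p; split.
have [||A tA|f fmin] := @ZL_preorder T t0 R.
- by move=> q; apply/asboolP.
- move=> r s t /asboolP rs /asboolP st; apply/asboolP => x.
  exact: le_trans (st x) (rs x).
- have [->|/set0P[a Aa]] := eqVneq A set0; first by exists t0.
  pose I x := [set sval q x | q in A].
  have hI x : has_inf (I x).
    split; first by exists (sval a x), a.
    exists (- p (- x)) => _ [[q [sq qp]] _ <-] /=.
    have := sublinear_ge x 0 sq; rewrite addr0 sublinear0// subr0.
    by apply: le_trans; rewrite lerN2.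
  have Ile (q : T) x : A q -> inf (I x) <= sval q x.
    by move=> Aq; apply: ge_inf; [case: (hI x)|exists q].
  have sI : sublinear (fun x => inf (I x)) /\ forall x, inf (I x) <= p x.
    split; last by move=> x; rewrite (le_trans (Ile _ x Aa))//; case: (svalP a).
    split=> [x y|c x c0]; apply/ler_addgt0Pr => e e0.
      have e2 : 0 < e / 2 by rewrite divr_gt0.
      have [_ [q Aq <-] ltq] := inf_adherent e2 (hI x).
      have [_ [r Ar <-] ltr] := inf_adherent e2 (hI y).
      (* In a chain, the smaller of the two near-minimizers serves at both points. *)
      have [/asboolP le|/asboolP le] := tA _ _ Aq Ar.
        have [[rD _] _] := svalP r; have := rD x y; have := le x.
        have := Ile _ (x + y) Ar; lra.
      have [[qD _] _] := svalP q; have := qD x y; have := le y.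
      have := Ile _ (x + y) Aq; lra.
    have ec : 0 < e / c by rewrite divr_gt0.
    have [_ [q Aq <-] ltq] := inf_adherent ec (hI x).
    have [[_ qZ] _] := svalP q.
    apply: (le_trans (Ile _ _ Aq)); apply: (le_trans (qZ _ _ c0)).
    have : c * sval q x < c * (inf (I x) + e / c) by rewrite ltr_pM2l.
    by rewrite [ltRHS]mulrDr (mulrC e) mulVKf ?gt_eqF// => /ltW.
  exists (exist P _ sI) => q Aq; apply/asboolP => x; exact: Ile.
case: f fmin => f [sf fp] fmin; have [fD fZ] := sf.
have fN x : f (- x) = - f x.
  have sg : sublinear (slope f x) /\ forall y, slope f x y <= p y.
    split; first exact: sublinear_slope.
    by move=> y; rewrite (le_trans _ (fp y))// slope_le_id.
  (* Minimality gives [f <= slope f x], hence [f (- x) <= - f x]. *)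
  have /fmin/asboolP/(_ (- x))/= : R (exist P f (conj sf fp)) (exist P _ sg).
    by apply/asboolP => y /=; exact: slope_le_id.
  have := slope_opp x sf; have := fD x (- x); rewrite subrr sublinear0//; lra.
have fA x y : f (x + y) = f x + f y.
  by apply/eqP; rewrite eq_le fD/=; have := fD (x + y) (- y); rewrite addrK fN; lra.
have fM a x : f (a *: x) = a * f x.
  have [a0|a0] := leP 0 a; first exact: sublinearZ.
  rewrite -[a in LHS]opprK scaleNr fN (sublinearZ _ sf) ?oppr_ge0 ?ltW//.
  by rewrite mulNr opprK.
have fl : linear (f : E -> K^o) by move=> a x y; rewrite fA fM.
pose m := GRing.isLinear.Build K E K^o *:%R f fl.
pose F : {linear E -> K^o} := HB.pack f m.
by exists F.
Qed.

(** A linear function below [slope p x0] is at most [- p x0] at [- x0], hence at least [p x0] at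
    [x0]. *)
Lemma hahn_banach p x0 : sublinear p ->
  exists f : {linear E -> K^o}, (forall x, f x <= p x) /\ f x0 = p x0.
Proof.
move=> sp; have [f fp] := exists_linear_le (sublinear_slope x0 sp).
exists f; have fle x : f x <= p x by rewrite (le_trans (fp x))// slope_le_id.
split=> //; apply/eqP; rewrite eq_le fle/=.
by have := le_trans (fp _) (slope_opp x0 sp); rewrite raddfN lerN2.
Qed.

End HahnBanach.

(** * Geometrically dominated series and bounded operators *)

Section Series.
Variable K : realType.

Lemma geometric_half_le n : series (geometric 1 (2^-1 : K)) n <= 2.
Proof.
have h : (0 : K) < 2^-1 by rewrite invr_gt0.
have h1 : `|2^-1 : K| < 1 by rewrite gtr0_norm// invf_lt1// ltr1n.
apply: (le_trans (geometric_le_lim n ler01 h h1)).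
have -> : (1 : K) - 2^-1 = 2^-1 by lra.
by rewrite mul1r invrK.
Qed.

Lemma cvg_geometric_dominated (V : completeNormedModType K) (v : nat -> V) C :
  (forall k, `|v k| <= C * 2^-1 ^+ k) ->
  exists2 s, series v @ \oo --> s & `|s| <= C * 2.
Proof.
move=> vC; have C0 : 0 <= C by have := vC 0; rewrite expr0 mulr1; exact: le_trans.
have cv : cvgn (series v).
  apply: normed_cvg; apply: (series_le_cvg _ _ vC) => [n|n|] //.
    by rewrite mulr_ge0// exprn_ge0.
  apply: (@is_cvg_geometric_series _ C 2^-1).
  by rewrite ger0_norm// invf_lt1// ltr1n.
exists (limn (series v)) => //.
have cn : `|series v n| @[n --> \oo] --> `|limn (series v)| by exact: cvg_norm.
rewrite -(cvg_lim _ cn)//; apply: limr_le; first exact: cvgP cn.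
near=> n; rewrite /series /= (le_trans (ler_norm_sum _ _ _))//.
apply: (@le_trans _ _ (C * series (geometric 1 2^-1) n)).
  by rewrite /series /= mulr_sumr ler_sum// => k _; rewrite mul1r.
by rewrite ler_wpM2l// geometric_half_le.
Unshelve. all: by end_near. Qed.

Lemma bounded_operator_continuous (V W : normedModType K) (f : {linear V -> W}) M :
  (forall x, `|f x| <= M * `|x|) -> continuous f.
Proof.
move=> fM; apply: bounded_linear_continuous; apply/linear_boundedP; near=> r => x.
by rewrite (le_trans (fM x))// ler_wpM2r//; near: r; exact: nbhs_pinfty_ge.
Unshelve. all: by end_near. Qed.

Lemma bounded_operator_cvg (V W : normedModType K) (f : {linear V -> W}) M
    (v : nat -> V) s :
  (forall x, `|f x| <= M * `|x|) -> v @ \oo --> s -> f \o v @ \oo --> f s.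
Proof.
move=> fM; apply: continuous_cvg; exact: (bounded_operator_continuous fM).
Qed.

End Series.

(** * Finite and infinite codimension through linear dependence *)

Section Dimension.
Variable K : realType.

Lemma linear_pack (V W : lmodType K) (phi : V -> W) : linear phi ->
  exists psi : {linear V -> W}, psi =1 phi.
Proof.
move=> phil; pose m := GRing.isLinear.Build K V W *:%R phi phil.
by pose psi : {linear V -> W} := HB.pack phi m; exists psi.
Qed.

(** The coordinate rows of [n + 1] vectors in a spanning family of size [n] form a matrix with more
    rows than columns, so its left kernel is nonzero. *)
Lemma finite_dim_dependent (V : lmodType K) (x : nat -> V) : finite_dim V ->
  exists n (c : 'I_n -> K), (exists i, c i != 0) /\ \sum_(i < n) c i *: x i = 0.
Proof.
move=> [n [v spanv]]; have [a xa] := choice (fun j => spanv (x j)).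
pose M : 'M[K]_(n.+1, n) := \matrix_(j, i) a j i.
have : kermx M != 0.
  by rewrite -mxrank_eq0 mxrank_ker subn_eq0 -ltnNge ltnS rank_leq_col.
case/rowV0Pn => c /sub_kermxP cM; case/rV0Pn => i ci.
exists n.+1, (c 0); split; first by exists i.
under eq_bigr do rewrite xa scaler_sumr.
rewrite exchange_big big1// => k _.
under eq_bigr do rewrite scalerA.
rewrite -scaler_suml; have /matrixP/(_ 0 k) := cM; rewrite !mxE.
under eq_bigr do rewrite mxE.
by move=> ->; rewrite scale0r.
Qed.

Lemma quot_lmod_eq0 (E : lmodType K) (S : submodClosed E) x :
  (quot_lmod_pi S x = 0) <-> x \in S.
Proof.
rewrite -(raddf0 (quot_lmod_pi S)); split=> [/eqP|xS].
  by rewrite quot_lmod_pi_eq subr0.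
by apply/eqP; rewrite quot_lmod_pi_eq subr0.
Qed.

Lemma infinite_codim_independent (E : lmodType K) (S : submodClosed E)
    (x : nat -> E) :
  (forall n (c : 'I_n -> K), \sum_(i < n) c i *: x i \in S -> forall i, c i = 0) ->
  infinite_codim S.
Proof.
move=> indep /(@finite_dim_dependent _ (quot_lmod_pi S \o x))[n [c [[i ci]]]].
under eq_bigr do rewrite /= -linearZ.
rewrite -linear_sum => /quot_lmod_eq0/indep/(_ i)/eqP.
by rewrite (negPf ci).
Qed.

Lemma finite_codim_span (E : lmodType K) (S : submodClosed E) n (e : nat -> E) :
  (forall x, exists c : nat -> K, x - \sum_(i < n) c i *: e i \in S) ->
  finite_codim S.
Proof.
move=> spane; exists n, (fun i => quot_lmod_pi S (e i)) => q.
have [x <-] := quot_lmod_pi_surj q; have [c xc] := spane x.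
exists (fun i => c i); under eq_bigr do rewrite -linearZ.
by rewrite -linear_sum; apply/eqP; rewrite quot_lmod_pi_eq.
Qed.

End Dimension.

(** * The quotient seminorm *)

Section Quotient.
Variables (K : realType) (E : normedModType K) (L : closedSubspace E).

Lemma quot_map_eq0 x : (quot_map L x = 0) <-> x \in L.
Proof. exact: quot_lmod_eq0. Qed.

Lemma norm_quot_map_le x : `|quot_map L x| <= `|x|.
Proof. exact: quot_norm_le. Qed.

Lemma norm_quot_map_adherent x e : 0 < e ->
  exists2 y, quot_map L y = quot_map L x & `|y| < `|quot_map L x| + e.
Proof. exact: quot_norm_adherent. Qed.

Lemma sublinear_norm_quot : sublinear (fun x => `|quot_map L x|).
Proof.
split=> [x y|a x a0]; first by rewrite raddfD ler_normD.
by rewrite linearZ normrZ gtr0_norm.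
Qed.

End Quotient.

(** * Open mapping argument: functionals small on an operator range *)

Section NearSurjectivity.
Variables (K : realType) (E : normedModType K) (G : completeNormedModType K).
Variables (A : {linear G -> E}) (MA : K) (M : closedSubspace E).
Hypothesis AM : forall g, `|A g| <= MA * `|g|.

(** An infimal convolution: a linear functional below it satisfies both [|f (A g)| <= |g|] and
    [|f y| <= t * |quot_map M y|]. *)
Definition mixed_norm (t : K) (x : E) : K :=
  inf (range (fun g => `|g| + t * `|quot_map M (x - A g)|)).

Lemma mixed_norm_has_inf t x : 0 <= t ->
  has_inf (range (fun g => `|g| + t * `|quot_map M (x - A g)|)).
Proof.
move=> t0; split; first by exists (`|(0 : G)| + t * `|quot_map M (x - A 0)|), 0.
by exists 0 => _ [g _ <-]; rewrite addr_ge0// mulr_ge0.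
Qed.

Lemma mixed_norm_le t x g : 0 <= t ->
  mixed_norm t x <= `|g| + t * `|quot_map M (x - A g)|.
Proof.
by move=> t0; apply: ge_inf; [case: (mixed_norm_has_inf x t0)|exists g].
Qed.

Lemma mixed_norm_adherent t x e : 0 <= t -> 0 < e ->
  exists g, `|g| + t * `|quot_map M (x - A g)| < mixed_norm t x + e.
Proof.
move=> t0 e0; have [_ [g _ <-] lt] := inf_adherent e0 (mixed_norm_has_inf x t0).
by exists g.
Qed.

Lemma sublinear_mixed_norm t : 0 <= t -> sublinear (mixed_norm t).
Proof.
move=> t0; split=> [x y|a x a0]; apply/ler_addgt0Pr => e e0.
  have e2 : 0 < e / 2 by rewrite divr_gt0.
  have [g ltg] := mixed_norm_adherent x t0 e2.
  have [k ltk] := mixed_norm_adherent y t0 e2.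
  have := mixed_norm_le (x + y) (g + k) t0.
  rewrite (raddfD A) opprD addrACA (raddfD (quot_map M))/=.
  have := ler_wpM2l t0 (ler_normD (quot_map M (x - A g)) (quot_map M (y - A k))).
  rewrite mulrDr; have := ler_normD g k; lra.
have ea : 0 < e / a by rewrite divr_gt0.
have [g ltg] := mixed_norm_adherent x t0 ea.
have := mixed_norm_le (a *: x) (a *: g) t0.
rewrite (linearZ_LR A) -scalerBr (linearZ_LR (quot_map M)) !normrZ gtr0_norm// mulrCA -mulrDr.
move=> /le_trans; apply; apply: ltW.
have -> : a * mixed_norm t x + e = a * (mixed_norm t x + e / a).
  by rewrite mulrDr (mulrC e) mulVKf ?gt_eqF.
by rewrite ltr_pM2l.
Qed.

Lemma mixed_norm_le_quot t x : 0 <= t ->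
  mixed_norm t x <= t * `|quot_map M x|.
Proof.
by move=> t0; have := mixed_norm_le x 0 t0; rewrite raddf0 subr0 normr0 add0r.
Qed.

Lemma mixed_norm_range t g : 0 <= t -> mixed_norm t (A g) <= `|g|.
Proof.
by move=> t0; have := mixed_norm_le (A g) g t0; rewrite subrr raddf0 normr0 mulr0 addr0.
Qed.

(* A bound on all the [mixed_norm t] makes every [x] approximable modulo [M] by
   some [A g] with [|g|] controlled; successive approximations then sum up to an
   exact preimage, as in the open mapping theorem. *)
Lemma mixed_norm_bounded_surj C :
  (forall t x, 0 <= t -> mixed_norm t x <= C * `|x|) ->
  forall x, exists g, x - A g \in M.
Proof.
move=> pC; have C0 : 0 <= `|C| by [].
have step x : exists g, `|g| <= (2 * `|C| + 1) * `|quot_map M x| /\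
    `|quot_map M (x - A g)| <= 2^-1 * `|quot_map M x|.
  (* The number [|quot_map M x|] serves as a positive error below, hence the separate zero case. *)
  have [Qx0|Qx0] := eqVneq (quot_map M x) 0.
    by exists 0; rewrite raddf0 subr0 normr0 Qx0 normr0 !mulr0.
  have q0 : 0 < `|quot_map M x| by rewrite normr_gt0.
  have [y Qy lty] := norm_quot_map_adherent M x q0.
  (* The weight is twice the factor in the bound [h], so that [h] halves the quotient norm. *)
  pose t := 2 * (2 * `|C| + 1); have t0 : 0 <= t by rewrite /t; lra.
  have [g ltg] := mixed_norm_adherent y t0 q0; exists g.
  have Qg : quot_map M (y - A g) = quot_map M (x - A g).
    by rewrite !(raddfB (quot_map M))/= Qy.
  rewrite Qg in ltg.
  have Cy : C * `|y| <= 2 * `|C| * `|quot_map M x|.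
    apply: (le_trans (ler_wpM2r (normr_ge0 y) (ler_norm C))).
    by have := ler_wpM2l C0 (ltW lty); rewrite mulrDr; lra.
  have := pC t y t0 => py.
  have h : `|g| + t * `|quot_map M (x - A g)| <= (2 * `|C| + 1) * `|quot_map M x|.
    by rewrite mulrDl mul1r; lra.
  split; first by have := mulr_ge0 t0 (normr_ge0 (quot_map M (x - A g))); lra.
  have D0 : 0 < 2 * `|C| + 1 by lra.
  rewrite -(ler_pM2l D0); have := normr_ge0 g; rewrite /t in h; lra.
move=> x; have [gam gamP] := choice step.
pose X := fun k => iter k (fun z => z - A (gam z)) x.
pose q := `|quot_map M x|.
have Xle k : `|quot_map M (X k)| <= q * 2^-1 ^+ k.
  elim: k => [|k IH]; first by rewrite expr0 mulr1.
  have [_ h] := gamP (X k); apply: (le_trans h).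
  by rewrite exprS mulrCA ler_wpM2l.
have D0 : 0 <= 2 * `|C| + 1 by lra.
have [|g cvg_g _] := @cvg_geometric_dominated K G (gam \o X) ((2 * `|C| + 1) * q).
  move=> k; have [h _] := gamP (X k); apply: (le_trans h).
  by rewrite -mulrA ler_wpM2l.
exists g; apply/quot_map_eq0/eqP; rewrite -normr_le0.
have XE n : X n = x - A (series (gam \o X) n).
  elim: n => [|n IH]; first by rewrite /series /= big_geq// raddf0 subr0.
  by rewrite /series /= big_nat_recr//= raddfD opprD addrA -IH.
have cvgA : A (series (gam \o X) n) @[n --> \oo] --> A g.
  exact: (bounded_operator_cvg AM cvg_g).
(* This null sequence dominates [|quot_map M (x - A g)|] for every [n]. *)
have cvgX : q * 2^-1 ^+ n + `|A g - A (series (gam \o X) n)| @[n --> \oo] --> 0 + `|A g - A g|.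
  apply: cvgD.
    apply: (@cvg_geometric _ q 2^-1).
    by rewrite ger0_norm// invf_lt1// ltr1n.
  by apply: cvg_norm; apply: cvgB => //; exact: cvg_cst.
rewrite subrr normr0 addr0 in cvgX.
rewrite -(cvg_lim _ cvgX)//; apply: limr_ge; first exact: cvgP cvgX.
near=> n; have -> : x - A g = X n - (A g - A (series (gam \o X) n)).
  by rewrite XE opprB addrA subrK.
rewrite (raddfB (quot_map M)).
apply: le_trans (ler_normB _ _) _; apply: lerD; first exact: Xle.
exact: norm_quot_map_le.
Unshelve. all: by end_near. Qed.

(** Failure of surjectivity modulo [M] makes some [mixed_norm t x] exceed [B * |x|]; Hahn-Banach at
    [x] gives a functional below [mixed_norm t], from which all its bounds follow. *)
Lemma exists_small_on_range : ~ (forall x, exists g, x - A g \in M) ->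
  forall B, 0 < B -> exists (x : E) (f : {linear E -> K^o}),
  [/\ B * `|x| < f x, (forall y, y \in M -> f y = 0),
      (forall g, `|f (A g)| <= `|g|) & exists C, forall y, `|f y| <= C * `|y|].
Proof.
move=> nsurj B B0.
have [t [x [t0 ltx]]] : exists t x, 0 <= t /\ B * `|x| < mixed_norm t x.
  apply: contrapT => H; apply: nsurj; apply: (@mixed_norm_bounded_surj B) => t x t0.
  by rewrite leNgt; apply/negP => lt; apply: H; exists t, x.
have [f [fp fx]] := hahn_banach x (sublinear_mixed_norm t0).
have fabs y c : mixed_norm t y <= c -> mixed_norm t (- y) <= c -> `|f y| <= c.
  move=> h1 h2; rewrite ler_norml (le_trans (fp y) h1) andbT.
  by rewrite lerNl -raddfN (le_trans (fp _) h2).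
have fQ y : `|f y| <= t * `|quot_map M y|.
  by apply: fabs; rewrite (le_trans (mixed_norm_le_quot _ t0))// raddfN normrN.
exists x, f; split; first by rewrite fx.
- move=> y /quot_map_eq0 Qy; apply/eqP; rewrite -normr_le0.
  by have := fQ y; rewrite Qy normr0 mulr0.
- move=> g; apply: fabs; first exact: mixed_norm_range.
  by rewrite -raddfN -[leRHS]normrN mixed_norm_range.
- exists t => y; rewrite (le_trans (fQ y))// ler_wpM2l//.
  exact: norm_quot_map_le.
Qed.

End NearSurjectivity.

(** * Finite biorthogonal systems and their projections *)

Section Biorthogonal.
Variables (K : realType) (E : normedModType K) (L : closedSubspace E).

Local Notation pair_of := (E * {linear E -> K^o})%type.

Definition bounded_annihilator (f : {linear E -> K^o}) :=
  (forall x, x \in L -> f x = 0) /\ exists C, forall x, `|f x| <= C * `|x|.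

Definition biorthogonal n (P : nat -> pair_of) :=
  (forall i, (i < n)%N -> bounded_annihilator (P i).2) /\
  (forall i j, (i < n)%N -> (j < n)%N -> (P i).2 (P j).1 = (i == j)%:R).

(** For a biorthogonal system, the projection onto the common kernel of the functionals along the
    span of the vectors. *)
Definition residue n (P : nat -> pair_of) (x : E) : E :=
  x - \sum_(i < n) (P i).2 x *: (P i).1.

Variables (n : nat) (P : nat -> pair_of).
Hypothesis bioP : biorthogonal n P.

Lemma residue_is_linear : linear (residue n P).
Proof.
move=> a x y; rewrite /residue scalerBr scaler_sumr addrACA -opprD -big_split/=.
congr (_ - _); apply: eq_bigr => i _.
by rewrite linearP scalerDl scalerA.
Qed.

HB.instance Definition _ :=
  GRing.isLinear.Build K E E *:%R (residue n P) residue_is_linear.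

Lemma residue_ker i x : (i < n)%N -> (P i).2 (residue n P x) = 0.
Proof.
move=> ltin; rewrite /residue raddfB/= linear_sum/= (bigD1 (Ordinal ltin))//=.
rewrite linearZ/= (bioP.2 _ _ ltin ltin) eqxx big1 => [|j].
  by rewrite addr0 /GRing.scale/= mulr1 subrr.
rewrite -val_eqE/= => ji; rewrite linearZ/= bioP.2// eq_sym (negPf ji).
exact: scaler0.
Qed.

Lemma residue_id x : (forall i, (i < n)%N -> (P i).2 x = 0) -> residue n P x = x.
Proof.
move=> Px; rewrite /residue big1 ?subr0// => i _.
by rewrite Px// scale0r.
Qed.

Lemma residue_subspace x : x \in L -> residue n P x = x.
Proof. by move=> xL; apply: residue_id => i /bioP.1[->]. Qed.

Lemma residue_vec j : (j < n)%N -> residue n P (P j).1 = 0.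
Proof.
move=> ltjn; rewrite /residue (bigD1 (Ordinal ltjn))//= bioP.2// eqxx scale1r.
rewrite big1 ?addr0 ?subrr// => i.
by rewrite -val_eqE/= => ij; rewrite bioP.2// (negPf ij) scale0r.
Qed.

Lemma residue_bounded : exists2 C, 0 < C & forall x, `|residue n P x| <= C * `|x|.
Proof.
have /choice[C PC] i : exists C, (i < n)%N -> forall x, `|(P i).2 x| <= C * `|x|.
  have [/bioP.1[_ [C PC]]|_] := boolP (i < n)%N; first by exists C.
  by exists 0.
exists (1 + \sum_(i < n) `|C i| * `|(P i).1|).
  by rewrite ltr_pwDl// sumr_ge0// => i _; rewrite mulr_ge0.
move=> x; rewrite mulrDl mul1r (le_trans (ler_normB _ _))// lerD2l.
rewrite (le_trans (ler_norm_sum _ _ _))// mulr_suml ler_sum// => i _.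
rewrite normrZ mulrAC ler_wpM2r// (le_trans (PC i _ _))// ler_wpM2r//.
exact: ler_norm.
Qed.

Lemma residue_continuous : continuous (residue n P).
Proof.
by have [C _ PC] := residue_bounded; exact: (bounded_operator_continuous PC).
Qed.

(* The subspace [L + span (e_i)], which is closed as the preimage of [L] under a
   continuous map. *)
Lemma residue_preimage : exists M : closedSubspace E,
  forall x, (x \in M) = (residue n P x \in L).
Proof.
have [||M ME] := @Defs.closed_subspaceP K E [pred x | residue n P x \in L].
- by split=> [|a x y]; rewrite !inE ?linear0 ?rpred0// linearP => ? ?; rewrite rpredD// rpredZ.
- apply: (@closed_comp _ _ (residue n P) [set` L]); last exact: closed_subspace.
  by move=> x _; exact: residue_continuous.
by exists M => x; rewrite ME.
Qed.

(** The common kernel is the fixed-point set of the continuous map [residue n P], hence closed. *)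
Lemma common_kernel : exists W : closedSubspace E,
  (forall x, x \in W <-> forall i, (i < n)%N -> (P i).2 x = 0).
Proof.
have [||W WE] := @Defs.closed_subspaceP K E [pred x | residue n P x == x].
- split=> [|a x y]; rewrite !inE ?linear0// => /eqP xE /eqP yE.
  by rewrite linearP/= xE yE.
- rewrite [X in closed X](_ : _ = (fun x => residue n P x - x) @^-1` [set 0]).
    apply: closed_comp => [x _|]; last first.
      exact: accessible_closed_set1 (hausdorff_accessible (@norm_hausdorff _ _)) _.
    by apply: cvgB => //; exact: residue_continuous.
  apply/seteqP; split=> x /=; rewrite inE ?subr_eq0 => /eqP//.
    by move=> ->; rewrite subrr.
  by rewrite subr_eq0.
exists W => x; rewrite WE inE; split=> [/eqP <- i|/residue_id->//].
exact: residue_ker.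
Qed.

End Biorthogonal.

(** * Adding one pair to a finite biorthogonal system *)

Section Extension.
Variables (K : realType) (E F : normedModType K) (L : closedSubspace E).
Variables (T : {linear E -> F}) (G : completeNormedModType K).
Variables (A : {linear G -> E}) (R : submodClosed E).
Variables (n : nat) (P : nat -> E * {linear E -> K^o}).
Hypothesis bioP : biorthogonal L n P.

(** The conditions under which [P] stays biorthogonal once [p] is placed at index [n]. *)
Definition extends (p : E * {linear E -> K^o}) :=
  [/\ bounded_annihilator L p.2, p.2 p.1 = 1,
      forall i, (i < n)%N -> (P i).2 p.1 = 0 &
      forall i, (i < n)%N -> p.2 (P i).1 = 0].

(** If [A] were onto modulo [M], the sum of [L] and the span of the vectors, then [L + R] would have
    finite codimension. So some functional vanishing on [M] is small on the range relative to its
    value at some [x]; projecting and rescaling give the pair. *)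
Lemma extend_small_on_range : bounded_operator A -> range A = [set` R] ->
  infinite_codim (sum_subspace L R) ->
  forall e, 0 < e ->
  exists p, [/\ extends p, `|p.1| <= 1 & forall g, `|p.2 (A g)| <= e * `|g|].
Proof.
move=> [MA AM] AR codimLR e e0.
have [C C0 PC] := residue_bounded bioP.
have [M ME] := residue_preimage bioP.
have nsurj : ~ (forall x, exists g, x - A g \in M).
  move=> surj; apply: codimLR.
  apply: (@finite_codim_span _ _ _ n (fun i => (P i).1)) => x.
  have [g] := surj x; rewrite ME /residue => xL.
  exists (fun i => (P i).2 (x - A g)); apply/asboolP.
  exists (x - A g - \sum_(i < n) (P i).2 (x - A g) *: (P i).1), (A g); split => //.
    by have : range A (A g) by [exists g]; rewrite AR.
  by rewrite addrAC subrK.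
(* With the constant [C / e], the scaling factor [s / f x], where [s = C * |x|], is below [e]. *)
have [x [f [ltf fM fA [B fB]]]] := exists_small_on_range AM nsurj (divr_gt0 C0 e0).
have b0 : 0 < f x by apply: le_lt_trans ltf; rewrite mulr_ge0// divr_ge0// ltW.
have fe i : (i < n)%N -> f (P i).1 = 0.
  by move=> ltin; apply: fM; rewrite ME (residue_vec bioP)// rpred0.
have fL y : y \in L -> f y = 0 by move=> yL; rewrite fM// ME (residue_subspace bioP).
(* Each [(P i).1] lies in [M], so projecting [x] does not change the value of [f]. *)
have fres : f (residue n P x) = f x.
  rewrite /residue raddfB/= linear_sum/= big1 ?subr0// => i _.
  by rewrite linearZ/= fe// scaler0.
have x0 : 0 < `|x|.
  by rewrite normr_gt0; apply: contraTneq b0 => ->; rewrite raddf0 ltxx.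
pose s := C * `|x|; have s0 : 0 < s by rewrite mulr_gt0.
have [|h hE] := @linear_pack K E K^o (fun y => s / f x * f y).
  by move=> a y z; rewrite linearP/= mulrDr mulrCA.
exists (s^-1 *: residue n P x, h); split=> /=.
- split=> /=.
  + split=> [y yL|]. by rewrite hE (fL _ yL) mulr0.
    exists (`|s / f x| * B) => y; rewrite hE normrM -mulrA.
    by rewrite ler_wpM2l.
  + by rewrite hE linearZ/= fres /GRing.scale/=; field; rewrite !gt_eqF.
  + by move=> i ltin; rewrite linearZ/= (residue_ker bioP)// scaler0.
  + by move=> i ltin; rewrite hE fe// mulr0.
- rewrite normrZ gtr0_norm ?invr_gt0// ler_pdivrMl// mulr1; exact: PC.
- move=> g; rewrite hE normrM gtr0_norm ?divr_gt0//.
  apply: ler_pM => //; first by rewrite divr_ge0// ltW.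
  rewrite ler_pdivrMr//; move: ltf; rewrite mulrAC ltr_pdivrMr// => /ltW.
  by rewrite (mulrC e).
Qed.

(* Kato's property on the common kernel of the functionals gives [u] with
   [T u] much smaller than [|Q_L u|], and Hahn-Banach a functional of norm at
   most one with value [|Q_L u|] at [u]. Composing it with the residue makes it
   vanish on the previous vectors at the cost of a factor [C] known beforehand,
   so a rescaling of the pair makes both estimates small. *)
Lemma extend_small_image : kato_property T L ->
  forall e, 0 < e ->
  exists p, [/\ extends p, `|T p.1| <= e & forall x, `|p.2 x| <= e * `|x|].
Proof.
move=> katoT e e0.
have [C C0 PC] := residue_bounded bioP.
have [W WE] := common_kernel bioP.
have codimW : finite_codim W.
  apply: (@finite_codim_span _ _ _ n (fun i => (P i).1)) => x.
  by exists (fun i => (P i).2 x); apply/WE => i; exact: (residue_ker bioP).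
have LW : {subset L <= W} by move=> x xL; apply/WE => i ltin; exact: (bioP.1 i ltin).1.
(* The vector will be scaled by [C / (e * q)] and the functional by [e / C]; this tolerance makes
   the image bound exactly [e]. *)
have e1 : 0 < e ^+ 2 / C by rewrite divr_gt0// exprn_gt0.
have [u [/WE uW uL Tu]] := katoT W codimW LW _ e1.
have q0 : 0 < `|quot_map L u|.
  by rewrite normr_gt0; apply: contra uL => /eqP/quot_map_eq0.
set q := `|quot_map L u| in q0 Tu.
have [f [fle fu]] := hahn_banach u (sublinear_norm_quot L).
rewrite -/q in fu.
have fQ x : `|f x| <= `|quot_map L x|.
  rewrite ler_norml fle andbT lerNl -raddfN (le_trans (fle _))//.
  by rewrite raddfN normrN.
have [|h hE] := @linear_pack K E K^o (fun y => e / C * f (residue n P y)).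
  by move=> a y z; rewrite linearP linearP/= mulrDr mulrCA.
have hle x : `|h x| <= e * `|x|.
  rewrite hE normrM gtr0_norm ?divr_gt0// mulrAC ler_pdivrMr// -mulrA ler_pM2l//.
  rewrite (le_trans (fQ _))// (le_trans (norm_quot_map_le _ _))// mulrC.
  exact: PC.
exists ((C / (e * q)) *: u, h); split=> //=.
- split=> /=.
  + split=> [y yL|]; last by exists e.
    rewrite hE (residue_subspace bioP)//.
    have -> : f y = 0.
      apply/eqP; rewrite -normr_le0 (le_trans (fQ _))//.
      by have /quot_map_eq0-> := yL; rewrite normr0.
    exact: mulr0.
  + rewrite hE linearZ linearZ/= residue_id// fu /GRing.scale/=.
    by field; rewrite !gt_eqF.
  + by move=> i ltin; rewrite linearZ/= uW// scaler0.
  + by move=> i ltin; rewrite hE (residue_vec bioP)// raddf0; exact: mulr0.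
- rewrite linearZ normrZ gtr0_norm; last by rewrite divr_gt0// mulr_gt0.
  have s0 : 0 <= C / (e * q) by rewrite divr_ge0// ltW// mulr_gt0.
  apply: (le_trans (ler_wpM2l s0 Tu)).
  have -> : C / (e * q) * (e ^+ 2 / C * q) = e by field; rewrite !gt_eqF.
  exact: lexx.
Qed.

End Extension.

(** * Recursion with history, and a partition of the indices *)

Lemma dependent_sequence (X : Type) (x0 : X)
    (next : nat -> (nat -> X) -> X -> Prop) :
  (forall n P Q x, (forall k, (k < n)%N -> P k = Q k) -> next n P x -> next n Q x) ->
  (forall n P, (forall k, (k < n)%N -> next k P (P k)) -> exists x, next n P x) ->
  exists P, forall n, next n P (P n).
Proof.
move=> ext step.
(* A next term is provided for every finite list of past terms, with [x0] as witness on inadmissible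
   lists. *)
have /choice[g gP] (s : seq X) : exists x,
    (forall k, (k < size s)%N -> next k (nth x0 s) (nth x0 s k)) ->
    next (size s) (nth x0 s) x.
  have [/step[x]|no] := pselect (forall k, (k < size s)%N ->
    next k (nth x0 s) (nth x0 s k)); first by exists x.
  by exists x0.
pose S n := iter n (fun s => rcons s (g s)) [::].
have sizeS n : size (S n) = n by elim: n => //= n IH; rewrite size_rcons IH.
pose P n := g (S n).
have nthS n k : (k < n)%N -> nth x0 (S n) k = P k.
  elim: n => //= n IH; rewrite ltnS nth_rcons sizeS leq_eqVlt.
  by case/predU1P=> [->|/[dup]/IH + ->//]; rewrite ltnn eqxx.
exists P => n; elim/ltn_ind: n => n IH.
(* [next n] only sees the terms below [n], where [P] agrees with the list [S n]. *)
apply: (ext _ (nth x0 (S n))) => [k|]; first exact: nthS.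
have := gP (S n); rewrite sizeS; apply => k ltkn.
rewrite nthS//; apply: (ext _ P) => [j ltjk|]; last exact: IH.
by rewrite nthS// (ltn_trans ltjk).
Qed.

(** The class [N_i] is the fibre over [i]. The 2-adic valuation makes all fibres infinite and keeps
    [owner j <= j], which turns decay in [j] into decay in [i]. *)
Definition owner (j : nat) : nat := logn 2 j.+1.

Lemma owner_le j : (owner j <= j)%N.
Proof. by rewrite -ltnS; exact: ltn_logl. Qed.

Lemma owner_infinite i n : exists2 j, (n <= j)%N & owner j = i.
Proof.
have p0 : (0 < 2 ^ i * n.*2.+1)%N by rewrite muln_gt0 expn_gt0.
(* The odd factor keeps the valuation of [j + 1] at [i] and makes [j] at least [n]. *)
exists (2 ^ i * n.*2.+1).-1.
  rewrite -ltnS prednK// (@leq_trans n.*2.+1)//; first by rewrite ltnS -addnn leq_addr.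
  by rewrite leq_pmull// expn_gt0.
by rewrite /owner prednK// lognM ?expn_gt0// lognX logn_prime// eqxx muln1
   logn_coprime ?addn0// coprime2n /= odd_double.
Qed.

(** * Infinite biorthogonal sequences and the glued functionals *)

Section BiorthogonalSequences.
Variables (K : realType) (E F : normedModType K) (L : closedSubspace E).
Variables (T : {linear E -> F}) (G : completeNormedModType K).
Variables (A : {linear G -> E}) (R : submodClosed E).
Hypotheses (bA : bounded_operator A) (AR : range A = [set` R]).
Hypotheses (codimLR : infinite_codim (sum_subspace L R)) (katoT : kato_property T L).

(** A single biorthogonal sequence alternates the two extension lemmas: even positions become the
    pairs [(u, f)], odd ones the pairs [(w, h)]. Halving the position gives the exponent [i] for the
    [i]-th pair of either kind. *)
Lemma exists_biorthogonal_sequences :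
  exists (u w : nat -> E) (f h : nat -> {linear E -> K^o}),
  [/\ forall i, bounded_annihilator L (f i) /\ bounded_annihilator L (h i),
      forall i j, [/\ f i (u j) = (i == j)%:R, f i (w j) = 0,
                      h i (u j) = 0 & h i (w j) = (i == j)%:R],
      forall i, `|u i| <= 1 /\ `|T (w i)| <= 8^-1 ^+ i,
      forall i g, `|f i (A g)| <= 8^-1 ^+ i * `|g| &
      forall i x, `|h i x| <= 8^-1 ^+ i * `|x|].
Proof.
pose next n P p := extends L n P p /\
  if odd n then `|T p.1| <= 8^-1 ^+ n./2 /\ forall x, `|p.2 x| <= 8^-1 ^+ n./2 * `|x|
  else `|p.1| <= 1 /\ forall g, `|p.2 (A g)| <= 8^-1 ^+ n./2 * `|g|.
(* The zero functional supplies the default pair required by the recursion. *)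
have [|z _] := @linear_pack K E K^o (fun=> 0).
  by move=> a x y; rewrite scaler0 addr0.
have [||P Pn] := @dependent_sequence _ (0 : E, z) next.
- move=> n P Q p PQ [[p1 p2 p3 p4] pn]; split=> //; split=> // i ltin.
    by rewrite -PQ// p3.
  by rewrite -PQ// p4.
- move=> n P PP; have bio : biorthogonal L n P.
    split=> [i /PP[[]]//|i j ltin ltjn].
    have [ltij|ltji|<-] := ltngtP i j.
    + by have [[_ _ h _] _] := PP j ltjn; exact: h.
    + by have [[_ _ _ h] _] := PP i ltin; exact: h.
    + by have [[]] := PP i ltin.
  have e0 : 0 < 8^-1 ^+ n./2 :> K by rewrite exprn_gt0// invr_gt0.
  rewrite /next; case: odd.
    by have [p [pe p1 p2]] := extend_small_image bio katoT e0; exists p.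
  by have [p [pe p1 p2]] := extend_small_on_range bio bA AR codimLR e0; exists p.
have bio i j : (P i).2 (P j).1 = (i == j)%:R.
  have [ltij|ltji|<-] := ltngtP i j.
  + by have [[_ _ h _] _] := Pn j; exact: h.
  + by have [[_ _ _ h] _] := Pn i; exact: h.
  + by have [[]] := Pn i.
exists (fun i => (P i.*2).1), (fun i => (P i.*2.+1).1).
exists (fun i => (P i.*2).2), (fun i => (P i.*2.+1).2); split.
- by move=> i; have [[? _ _ _] _] := Pn i.*2; have [[? _ _ _] _] := Pn i.*2.+1.
- move=> i j; rewrite !bio eqSS; split=> //.
  + by rewrite (inj_eq double_inj).
  + by case: eqP => // /(congr1 odd); rewrite /= !odd_double.
  + by case: eqP => // /(congr1 odd); rewrite /= !odd_double.
  + by rewrite (inj_eq double_inj).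
- move=> i; have [_] := Pn i.*2; have [_] := Pn i.*2.+1.
  by rewrite /= uphalf_double odd_double/= => -[? _] [? _].
- move=> i g; have [_] := Pn i.*2.
  by rewrite /= doubleK odd_double => -[_]; exact.
- move=> i g; have [_] := Pn i.*2.+1.
  by rewrite /= uphalf_double odd_double => -[_]; exact.
Qed.

(** [s] is the sum of the [h j] over the class of [i]. In [8^-j = 4^-j * 2^-j] the first factor is
    at most [4^-i], since [owner j <= j], and the second sums to at most 2. *)
Lemma linear_sum_along_owner (h : nat -> {linear E -> K^o}) :
  (forall j x, `|h j x| <= 8^-1 ^+ j * `|x|) -> forall i,
  exists s : {linear E -> K^o},
  [/\ forall x, `|s x| <= 2 * 4^-1 ^+ i * `|x|,
      forall x, (forall j, h j x = 0) -> s x = 0 &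
      forall x k, (forall j, h j x = (j == k)%:R) -> s x = (owner k == i)%:R].
Proof.
move=> hle i; pose v x j : K := (owner j == i)%:R * h j x.
have vle x j : `|v x j| <= 4^-1 ^+ i * `|x| * 2^-1 ^+ j.
  rewrite /v normrM; have [oj|_] := eqVneq; last first.
    by rewrite normr0 mul0r mulr_ge0// ?mulr_ge0// exprn_ge0.
  rewrite normr1 mul1r mulrAC (le_trans (hle j x))// ler_wpM2r//.
  have -> : 8^-1 = 4^-1 * 2^-1 :> K by rewrite -invfM -natrM.
  rewrite exprMn ler_wpM2r ?exprn_ge0// ler_wiXn2l//.
    by rewrite invf_le1// ler1n.
  by rewrite -oj owner_le.
have /choice[s sP] x : exists s : K^o,
    series (v x : nat -> K^o) @ \oo --> s /\ `|s| <= 4^-1 ^+ i * `|x| * 2.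
  by have [s ? ?] := @cvg_geometric_dominated K K^o _ _ (vle x); exists s.
have vlin a x y j : v (a *: x + y) j = a * v x j + v y j.
  have hlin : h j (a *: x + y) = a * h j x + h j y :> K by exact: linearP.
  by rewrite /v hlin mulrDr mulrCA.
have uniq x (l : K^o) : series (v x : nat -> K^o) @ \oo --> l -> s x = l.
  by apply: cvg_unique; [exact: norm_hausdorff|exact: (sP x).1].
have slin : linear s.
  move=> a x y; apply: uniq.
  have -> : series (v (a *: x + y) : nat -> K^o) =
      (fun n => a *: series (v x : nat -> K^o) n + series (v y : nat -> K^o) n).
    apply/funext => n; rewrite /series /= scaler_sumr -big_split/=.
    by apply: eq_bigr => j _; exact: vlin.
  by apply: cvgD; [apply: cvgZr; exact: (sP x).1|exact: (sP y).1].
have [S SE] := linear_pack slin; exists S; split=> [x|x hx|x k hx]; rewrite SE.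
- by have := (sP x).2; rewrite mulrC mulrA.
- apply: uniq; have -> : series (v x : nat -> K^o) = fun=> 0.
    by apply/funext => n; rewrite /series /= big1// => j _; rewrite /v hx mulr0.
  exact: cvg_cst.
- apply: uniq; apply: cvg_near_cst; near=> n; apply/eqP.
  have kn : (k < n)%N by near: n; exact: nbhs_infty_gt.
  rewrite /series /= big_mkord (bigD1 (Ordinal kn))//= /v hx eqxx mulr1 big1 ?addr0// => j.
  by rewrite -val_eqE/= hx => /negPf->; rewrite mulr0.
Unshelve. all: by end_near. Qed.

(** Take [g i = f i + s i]. At [A z] the first summand is at most [8^-i * |z|], the second at most
    [2 * 4^-i * |A z|], whence [D = 1 + 2 * |MA|]. *)
Lemma exists_glued_functionals :
  exists (u w : nat -> E) (g : nat -> {linear E -> K^o}) (D : K),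
  [/\ forall i, bounded_annihilator L (g i),
      forall i j, g i (u j) = (i == j)%:R /\ g i (w j) = (owner j == i)%:R,
      forall i, `|u i| <= 1,
      forall i, `|T (w i)| <= 8^-1 ^+ i &
      forall i z, `|g i (A z)| <= D * 4^-1 ^+ i * `|z|].
Proof.
have [u [w [f [h [ann bio uw fA hle]]]]] := exists_biorthogonal_sequences.
have [MA AM] := bA.
have /choice[s sP] := linear_sum_along_owner hle.
have /choice[g gE] i : exists g : {linear E -> K^o}, g =1 fun x => f i x + s i x.
  by apply: linear_pack => a x y; rewrite !linearP/= scalerDr addrACA.
exists u, w, g, (1 + 2 * `|MA|); split.
- move=> i; have [[fL [C fC]] _] := ann i; have [sle s0 _] := sP i; split=> [x xL|].
    rewrite gE fL// s0 ?addr0// => j; by have [_ [hL _]] := ann j; exact: hL.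
  exists (C + 2 * 4^-1 ^+ i) => x; rewrite gE mulrDl.
  by rewrite (le_trans (ler_normD _ _))// lerD.
- move=> i j; have [_ s0 s1] := sP i; split; rewrite gE.
    have [-> _ _ _] := bio i j; rewrite s0 ?addr0// => k.
    by have [] := bio k j.
  have [_ -> _ _] := bio i j; rewrite add0r (s1 _ j)// => k.
  by have [] := bio k j.
- by move=> i; have [] := uw i.
- by move=> i; have [] := uw i.
- move=> i z; rewrite gE (le_trans (ler_normD _ _))// -mulrA mulrDl mul1r lerD//.
    rewrite (le_trans (fA i z))// ler_wpM2r// lerXn2r ?nnegrE// lef_pV2 ?posrE//.
    by rewrite ler_nat.
  have [sle _ _] := sP i; rewrite (le_trans (sle _))//.
  rewrite -!mulrA ler_wpM2l// mulrCA ler_wpM2l ?exprn_ge0//.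
  by rewrite (le_trans (AM z))// ler_wpM2r// ler_norm.
Qed.

End BiorthogonalSequences.

(** * The common kernel of the glued functionals *)

Section GluedFunctionals.
Variables (K : realType) (E : completeNormedModType K) (F : normedModType K).
Variables (L : closedSubspace E) (T : {linear E -> F}) (R : submodClosed E).
Variables (G : completeNormedModType K) (A : {linear G -> E}).
Variables (u w : nat -> E) (g : nat -> {linear E -> K^o}) (D : K).
Hypothesis gL : forall i, bounded_annihilator L (g i).
Hypothesis gu : forall i j, g i (u j) = (i == j)%:R.
Hypothesis gw : forall i j, g i (w j) = (owner j == i)%:R.
Hypothesis u1 : forall i, `|u i| <= 1.
Hypothesis Tw : forall i, `|T (w i)| <= 8^-1 ^+ i.
Hypothesis gA : forall i z, `|g i (A z)| <= D * 4^-1 ^+ i * `|z|.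
Hypothesis AR : range A = [set` R].
Hypothesis denseR : dense [set` R].

Lemma expr_eventually_le (q e : K) : 0 < q < 1 -> 0 < e ->
  exists n, forall m, (n <= m)%N -> q ^+ m <= e.
Proof.
move=> /andP[q0 q1] e0.
have qn1 : `|q| < 1 by rewrite gtr0_norm.
have /cvgrPdist_le/(_ _ e0)[n _ nP] := @cvg_geometric K 1 q qn1.
exists n => m nm; have := nP m nm.
by rewrite /= mul1r sub0r normrN ger0_norm// exprn_ge0// ltW.
Qed.

(** A bounded functional passes to the limit, and by biorthogonality its value on the [n]-th partial
    sum is [a i] once [n > i]. *)
Lemma functional_series_coord (a : nat -> K) s i :
  series (fun k => a k *: u k) @ \oo --> s -> g i s = a i.
Proof.
move=> cs; have [_ [C gC]] := gL i.
have cg := bounded_operator_cvg gC cs.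
apply: (cvg_unique (@norm_hausdorff _ _) cg).
apply: cvg_near_cst; near=> n; apply/eqP.
have kn : (i < n)%N by near: n; exact: nbhs_infty_gt.
rewrite /= /series /= big_mkord linear_sum (bigD1 (Ordinal kn))//= linearZ/= gu eqxx.
rewrite big1 => [|j]; first by rewrite addr0 /GRing.scale/= mulr1.
by rewrite -val_eqE/= linearZ/= gu eq_sym => /negPf->; exact: scaler0.
Unshelve. all: by end_near. Qed.

Lemma common_kernel_sequence :
  exists E1 : closedSubspace E, forall x, x \in E1 <-> forall i, g i x = 0.
Proof.
have [||E1 E1E] := @Defs.closed_subspaceP K E [pred x | `[< forall i, g i x = 0 >]].
- split=> [|a x y]; first by apply/asboolP => i; rewrite linear0.
  move=> /asboolP xE /asboolP yE; apply/asboolP => i.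
  by rewrite linearP xE yE scaler0 addr0.
- rewrite [X in closed X](_ : _ = \bigcap_i (g i @^-1` [set 0])); last first.
    apply/seteqP; split=> x; first by move=> /asboolP gx i _; exact: gx.
    by move=> gx; apply/asboolP => i; exact: gx.
  apply: closed_bigI => i _; apply: closed_comp => [x _|]; last first.
    exact: accessible_closed_set1 (hausdorff_accessible (@norm_hausdorff _ _)) _.
  by have [_ [C gC]] := gL i; exact: (bounded_operator_continuous gC).
exists E1 => x; rewrite E1E; split=> [/asboolP//|gx]; exact/asboolP.
Qed.

Variable E1 : closedSubspace E.
Hypothesis E1P : forall x, x \in E1 <-> forall i, g i x = 0.

(* [E1 + span u] is dense: [A z] minus the convergent series of the
   [g k (A z) *: u k] lies in [E1]. *)
Lemma dense_kernel_span_ind (P : E -> Prop) :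
  (forall x, x \in E1 -> P x) -> (forall a k, P (a *: u k)) ->
  (forall x y, P x -> P y -> P (x + y)) ->
  (forall x, (forall e, 0 < e -> exists2 y, P y & `|x - y| <= e) -> P x) ->
  forall x, P x.
Proof.
move=> PE1 Pu PD Plim.
have PA z : P (A z).
  pose a k : K := g k (A z).
  have [k|s cs _] := @cvg_geometric_dominated K E (fun k => a k *: u k) (`|D| * `|z|).
    rewrite normrZ (le_trans (ler_wpM2l _ (u1 k)))// mulr1 (le_trans (gA k z))//.
    apply: (@le_trans _ _ (`|D| * 4^-1 ^+ k * `|z|)).
      by rewrite !ler_wpM2r ?exprn_ge0// ler_norm.
    rewrite mulrAC ler_wpM2l ?mulr_ge0// lerXn2r ?nnegrE// lef_pV2 ?posrE//.
    by rewrite ler_nat.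
  apply: Plim => e e0; have /cvgrPdist_le/(_ _ e0)[n _ nP] := cs.
  (* [A z - s] lies in [E1], and the partial sum is a finite sum of multiples of the [u k]. *)
  exists (A z - s + series (fun k => a k *: u k) n); last first.
    by rewrite opprD opprB addrA (addrC (A z)) subrK; apply: nP => /=.
  have Pz : P (A z - s).
    apply: PE1; apply/E1P => i; rewrite raddfB/= (functional_series_coord i cs).
    exact: subrr.
  rewrite /series /= big_mkord; elim/big_rec : _ => [|i x _ Px]; first by rewrite addr0; exact: Pz.
  by rewrite addrCA; exact: PD.
move=> x; apply: Plim => e e0.
have [|y [xy Ry]] := denseR (_ : ball x e !=set0) (@ball_open _ _ x e).
  by exists x; exact: ballxx.
have [z _ zy] : range A y by rewrite AR.
exists y; first by rewrite -zy.
by move: xy; rewrite -ball_normE/= => /ltW.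
Qed.

(** Rational combinations of the [u k], coded by lists and hence countable, have dense classes;
    [dense_kernel_span_ind] reduces this to [E1], whose class is zero, and to the multiples of
    [u k]. *)
Lemma separable_quot_kernel : separable (quot_space E1).
Proof.
pose d (l : seq (rat * nat)) := \sum_(p <- l) ratr p.1 *: u p.2 : E.
exists (range (quot_map E1 \o d)); first exact: sub_countable (card_image_le _ _) (countableP _).
move=> O [q Oq] openO; have [x xq] := quot_map_surj q.
have /nbhs_ballP[e /= e0 eO] : nbhs q O by apply: open_nbhs_nbhs.
pose P x := forall e, 0 < e -> exists l, `|quot_map E1 (x - d l)| <= e.
suff PA : forall x, P x.
  have [|l xl] := PA x (e / 2); first by rewrite divr_gt0.
  exists (quot_map E1 (d l)); split; last by exists l.
  apply: eO; rewrite -ball_normE/= -xq -(raddfB (quot_map E1)).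
  by rewrite (le_lt_trans xl)// ltr_pdivrMr// ltr_pMr// ltr1n.
apply: dense_kernel_span_ind => {x xq q Oq O openO e e0 eO}.
- move=> x xE e e0; exists [::]; rewrite /d big_nil subr0.
  by have /quot_map_eq0-> := xE; rewrite normr0 ltW.
- move=> a k e e0; have [r] : exists r, ratr r \in `]a - e, a + e[.
    by apply: rat_in_itvoo; lra.
  rewrite in_itv/= => /andP[r1 r2]; exists [:: (r, k)].
  rewrite /d big_seq1 /= -scalerBl (le_trans (norm_quot_map_le _ _))// normrZ.
  rewrite -[leRHS]mulr1 ler_pM// ler_norml; lra.
- move=> x y Px Py e e0; have e2 : 0 < e / 2 by rewrite divr_gt0.
  have [l xl] := Px _ e2; have [m ym] := Py _ e2; exists (l ++ m).
  rewrite /d big_cat/= opprD addrACA (raddfD (quot_map E1)).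
  by rewrite (le_trans (ler_normD _ _))// [e]splitr lerD.
- move=> x xlim e e0; have e2 : 0 < e / 2 by rewrite divr_gt0.
  have [y Py xy] := xlim _ e2; have [l yl] := Py _ e2; exists l.
  have -> : x - d l = (x - y) + (y - d l) by rewrite addrA subrK.
  rewrite (raddfD (quot_map E1)) (le_trans (ler_normD _ _))// [e]splitr lerD//.
  exact: le_trans (norm_quot_map_le _ _) xy.
Qed.

Lemma dense_image_kernel : bounded_operator T ->
  closure (T @` [set` E1]) = closure (range T).
Proof.
move=> [M TM]; apply/seteqP; split.
  by apply: closureS => _ [x _ <-]; exists x.
suff H : forall x e, 0 < e -> exists2 y, y \in E1 & `|T x - T y| <= e.
  rewrite [X in _ `<=` X]((closure_id _).1 (@closed_closure _ _)).
  apply: closureS => _ [x _ <-] B /nbhs_ballP[e /= e0 eB].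
  have [|y yE xy] := H x (e / 2); first by rewrite divr_gt0.
  exists (T y); split; first by exists y.
  apply: eB; rewrite -ball_normE/= (le_lt_trans xy)//.
  by rewrite ltr_pdivrMr// ltr_pMr// ltr1n.
apply: dense_kernel_span_ind.
- by move=> x xE e e0; exists x => //; rewrite subrr normr0 ltW.
- move=> a k e e0; have a0 : 0 < `|a| + 1 by rewrite ltr_wpDl.
  have h8 : 0 < (8^-1 : K) < 1 by apply/andP; split; lra.
  have [n nP] := expr_eventually_le h8 (divr_gt0 e0 a0).
  (* [j] is in the class of [k], so that [u k - w j] lies in [E1], and so large that [a *: T (w j)]
     has norm at most [e]; the added 1 covers [a = 0]. *)
  have [j nj oj] := owner_infinite k n.
  exists (a *: (u k - w j)).
    by apply/E1P => i; rewrite linearZ/= raddfB/= gu gw oj eq_sym subrr scaler0.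
  have -> : T (a *: u k) - T (a *: (u k - w j)) = a *: T (w j).
    by rewrite -(raddfB T) -scalerBr subKr; exact: linearZ.
  rewrite normrZ.
  rewrite (le_trans (ler_wpM2l _ (le_trans (Tw j) (nP j nj))))//.
  by rewrite mulrCA ler_piMr ?ltW// ltr_pdivrMr// mul1r ltrDl.
- move=> x y Px Py e e0; have e2 : 0 < e / 2 by rewrite divr_gt0.
  have [x' x'E xx'] := Px _ e2; have [y' y'E yy'] := Py _ e2.
  exists (x' + y'); first exact: rpredD.
  by rewrite !(raddfD T) opprD addrACA (le_trans (ler_normD _ _))// [e]splitr lerD.
- move=> x xlim e e0; have e2 : 0 < e / 2 by rewrite divr_gt0.
  have M0 : 0 < `|M| + 1 by rewrite ltr_wpDl.
  (* The tolerance is divided by [|M| + 1] so that [T (x - y)] costs at most [e / 2]. *)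
  have [y Py xy] := xlim _ (divr_gt0 e2 M0); have [z zE yz] := Py _ e2.
  exists z => //; have -> : T x - T z = T (x - y) + (T y - T z).
    by rewrite (raddfB T) addrA subrK.
  rewrite (le_trans (ler_normD _ _))// [e]splitr lerD// (le_trans (TM _))//.
  have h : M <= `|M| + 1 by rewrite (le_trans (ler_norm M))// lerDl.
  rewrite (le_trans (ler_wpM2r (normr_ge0 _) h))//.
  by rewrite -ler_pdivlMl// mulrC.
Qed.

(* The vectors [sum_k [owner k = j] 2^-k u k] are independent modulo [E1 + R]:
   on [E1 + R] the functionals [g i] decay like [4^-i]. *)
Lemma independent_mod_sum : exists x : nat -> E, forall n (c : 'I_n -> K),
  \sum_(j < n) c j *: x j \in sum_subspace E1 R -> forall j, c j = 0.
Proof.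
have /choice[x xP] (j : nat) : exists s : E,
    series (fun k => ((owner k == j)%:R * 2^-1 ^+ k : K) *: u k) @ \oo --> s.
  have [k|s cs _] := @cvg_geometric_dominated K E
    (fun k => ((owner k == j)%:R * 2^-1 ^+ k : K) *: u k) 1; last by exists s.
  have q0 : 0 <= 2^-1 ^+ k :> K by rewrite exprn_ge0.
  rewrite mul1r normrZ (le_trans (ler_wpM2l _ (u1 k)))// mulr1 normrM.
  by rewrite (ger0_norm q0) ler_piMl// normr_nat; case: eqP.
have gx i j : g i (x j) = (owner i == j)%:R * 2^-1 ^+ i.
  exact: (functional_series_coord i (xP j)).
exists x => n c /asboolP[y [r [/E1P gy Rr xE]]] j.
have [z _ zr] : range A r by rewrite AR.
(* At an index [i] of class [j] only the [j]-th term survives: [|c j| * 2^-i] is at most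
   [D * |z| * 4^-i], and [2^-i] cancels. *)
have cle i : owner i = j -> `|c j| <= D * `|z| * 2^-1 ^+ i.
  move=> oi; have := gA i z; rewrite zr.
  have -> : g i r = c j * 2^-1 ^+ i.
    have -> : g i r = g i (\sum_(j < n) c j *: x j).
      by rewrite xE raddfD/= gy add0r.
    rewrite linear_sum (bigD1 j)//= big1 => [|l lj].
      by rewrite linearZ/= gx oi eqxx mul1r addr0.
    have /negPf jl : nat_of_ord j != l by rewrite eq_sym.
    by rewrite linearZ/= gx oi jl mul0r scaler0.
  have q0 : 0 < 2^-1 ^+ i :> K by rewrite exprn_gt0// invr_gt0.
  rewrite normrM (gtr0_norm q0).
  have -> : 4^-1 = 2^-1 * 2^-1 :> K by rewrite -invfM -natrM.
  by rewrite exprMn mulrAC mulrA ler_pM2r.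
apply/eqP; rewrite -normr_le0; apply/ler_addgt0Pr => e e0; rewrite add0r.
have d0 : 0 < `|D * `|z| | + 1 by rewrite ltr_wpDl.
have h2 : 0 < (2^-1 : K) < 1 by apply/andP; split; lra.
have [m mP] := expr_eventually_le h2 (divr_gt0 e0 d0).
have [i mi oi] := owner_infinite j m.
have q0 : 0 <= 2^-1 ^+ i :> K by rewrite exprn_ge0.
have h : D * `|z| <= `|D * `|z| | + 1 by rewrite (le_trans (ler_norm _))// lerDl.
rewrite (le_trans (cle i oi))// (le_trans (ler_wpM2r q0 h))//.
by rewrite -ler_pdivlMl// mulrC mP.
Qed.

Lemma infinite_dim_quot_kernel :
  ~ finite_dim (quot_space E1) /\ infinite_codim (sum_subspace E1 R).
Proof.
have [x xind] := independent_mod_sum; split.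
  (* Independence modulo [E1 + R] implies independence modulo the smaller [E1]. *)
  apply: (@infinite_codim_independent _ _ E1 x) => n c cE; apply: xind.
  by apply/asboolP; exists (\sum_(j < n) c j *: x j), 0; rewrite rpred0 addr0.
exact: infinite_codim_independent xind.
Qed.

End GluedFunctionals.

Theorem theorem3p1 (K : realType) (E F : completeNormedModType K)
    (L : closedSubspace E) (T : {linear E -> F}) (R : submodClosed E) :
  infinite_codim L ->
  bounded_operator T ->
  kato_property T L ->
  proper_dense_operator_range R ->
  infinite_codim (sum_subspace L R) ->
  exists E1 : closedSubspace E,
    [/\ {subset L <= E1},
        separable (quot_space E1) /\ ~ finite_dim (quot_space E1),
        infinite_codim (sum_subspace E1 R) &
        closure (T @` [set` E1]) = closure (range T)].
Proof.
move=> _ bT katoT [[G [A [bA AR]]] denseR _] codimLR.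
have [u [w [g [D [gL bio u1 Tw gA]]]]] :=
  exists_glued_functionals bA AR codimLR katoT.
have gu i j : g i (u j) = (i == j)%:R by have [] := bio i j.
have gw i j : g i (w j) = (owner j == i)%:R by have [] := bio i j.
have [E1 E1P] := common_kernel_sequence gL.
have [dimE1 codimE1] := infinite_dim_quot_kernel gL gu u1 gA AR E1P.
exists E1; split=> //.
- by move=> x xL; apply/E1P => i; exact: (gL i).1.
- by split=> //; exact: (separable_quot_kernel gL gu u1 gA AR denseR E1P).
- exact: (dense_image_kernel gL gu gw u1 Tw gA AR denseR E1P).
Qed.
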